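(* Let $F\colon\mathbb{R}^{3\times 2}\to[0,\infty)$ be defined, for $A=(A_1\mid A_2)\in\mathbb{R}^{3\times 2}$ with columns $A_1,A_2\in\mathbb{R}^3$, by $$F(A):=G(\boldsymbol{e}_1+SA_1,\ \boldsymbol{e}_2+SA_2).$$ Then $F$ is rank-one convex and is not quasiconvex at $0$. More precisely, the map $\varphi_{\check S}\colon\mathbb{T}^2\to\mathbb{R}^3$, $$\varphi_{\check S}(x_1,x_2):=\sin x_1\,e_1+\sin x_2\,e_2+\sin(x_1+x_2)\,e_3,$$ satisfies $$\frac{1}{|\mathbb{T}^2|}\int_{\mathbb{T}^2}F(D\varphi_{\check S})\,dx=\frac{1}{|\mathbb{T}^2|}\int_{\mathbb{T}^2}G\bigl(I_2+D(S\varphi_{\check S})\bigr)\,dx\le\frac{\sqrt3}{2}<1=F(0)=G(I_2).$$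
   Context: $\mathbb{T}^2=\mathbb{R}^2/(2\pi\mathbb{Z})^2$, and $\{e_1,e_2,e_3\}$ is the canonical basis of $\mathbb{R}^3$. A locally Lipschitz function $F\colon\mathbb{R}^{m\times n}\to\mathbb{R}$ is quasiconvex at $A\in\mathbb{R}^{m\times n}$ if $\int_{\mathbb{T}^n}[F(A+D\varphi)-F(A)]\,dx\ge 0$ for all $\varphi\in C^\infty(\mathbb{T}^n,\mathbb{R}^m)$; it is rank-one convex if for all $A,X\in\mathbb{R}^{m\times n}$ with $\operatorname{rank}(X)=1$ the function $t\mapsto F(A+tX)$ is convex on $\mathbb{R}$. $\mathbb{H}$ denotes the real quaternions with units $\mathbf{i},\mathbf{j},\mathbf{k}$. For $\xi=(\xi_1,\xi_2),\eta=(\eta_1,\eta_2)\in\mathbb{H}^2$ set $\langle\xi,\eta\rangle_{\mathbb{H}^2}:=\xi_1\overline{\eta_1}+\xi_2\overline{\eta_2}\in\mathbb{H}$ and $\|\xi\|_{\mathbb{H}^2}^2:=\langle\xi,\xi\rangle_{\mathbb{H}^2}=|\xi_1|^2+|\xi_2|^2$. Define $$G\colon\mathbb{H}^2\times\mathbb{H}^2\to[0,\infty),\qquad G(\xi,\eta):=\sqrt{\|\xi\|_{\mathbb{H}^2}^2\|\eta\|_{\mathbb{H}^2}^2-|\langle\xi,\eta\rangle_{\mathbb{H}^2}|^2}.$$ A pair $(\xi,\eta)\in\mathbb{H}^2\times\mathbb{H}^2$ is identified with the matrix in $\mathbb{R}^{8\times 2}$ with columns $\xi,\eta$ (using $\mathbb{H}^2\cong\mathbb{R}^8$).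 Let $\boldsymbol{e}_1=(1,0)$, $\boldsymbol{e}_2=(0,1)$ be the standard basis of $\mathbb{H}^2$, and $I_2:=(\boldsymbol{e}_1,\boldsymbol{e}_2)$. Let $S\colon\mathbb{R}^3\to\mathbb{H}^2$ be the real-linear map $$S(r,s,t):=(-s\mathbf{j}-t\mathbf{k},\ r\mathbf{i}+t\mathbf{k}).$$ For $\varphi\colon\mathbb{T}^2\to\mathbb{R}^3$, $D(S\varphi)=(S\partial_{x_1}\varphi,\,S\partial_{x_2}\varphi)\in\mathbb{H}^2\times\mathbb{H}^2$. *)

(* Defs.v *)
From HB Require Import structures.
From mathcomp Require Import all_boot all_order all_algebra.
From mathcomp Require Import ring.
From mathcomp Require Import all_classical all_reals all_analysis.

Set Implicit Arguments.
Unset Strict Implicit.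
Unset Printing Implicit Defensive.

Import Order.TTheory GRing.Theory Num.Theory.
Import numFieldNormedType.Exports.

Local Open Scope classical_set_scope.
Local Open Scope ring_scope.

(* Quat a b c d is a + b i + c j + d k. *)
Record quat (R : Type) := Quat { qre : R; qim1 : R; qim2 : R; qim3 : R }.

Section QuatAlgebra.
Variable R : comNzRingType.
Local Notation H := (quat R).
Implicit Types p q : H.

Definition tuple_of_quat q := (qre q, qim1 q, qim2 q, qim3 q).
Definition quat_of_tuple (t : R * R * R * R) :=
  Quat t.1.1.1 t.1.1.2 t.1.2 t.2.

Fact tuple_of_quatK : cancel tuple_of_quat quat_of_tuple.
Proof. by case. Qed.

HB.instance Definition _ := Choice.copy H (can_type tuple_of_quatK).

Definition quat_zero : H := Quat 0 0 0 0.
Definition quat_one : H := Quat 1 0 0 0.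
Definition quat_opp p : H :=
  Quat (- qre p) (- qim1 p) (- qim2 p) (- qim3 p).
Definition quat_add p q : H :=
  Quat (qre p + qre q) (qim1 p + qim1 q) (qim2 p + qim2 q) (qim3 p + qim3 q).
Definition quat_mul p q : H :=
  let: Quat a b c d := p in let: Quat a' b' c' d' := q in
  Quat (a * a' - b * b' - c * c' - d * d')
       (a * b' + b * a' + c * d' - d * c')
       (a * c' - b * d' + c * a' + d * b')
       (a * d' + b * c' - c * b' + d * a').
Definition quat_scale (r : R) p : H :=
  Quat (r * qre p) (r * qim1 p) (r * qim2 p) (r * qim3 p).

Fact quat_addA : associative quat_add.
Proof. by case=> ? ? ? ? [? ? ? ?] [? ? ? ?]; congr Quat; apply: addrA. Qed.
Fact quat_addC : commutative quat_add.
Proof. by case=> ? ? ? ? [? ? ? ?]; congr Quat; apply: addrC. Qed.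
Fact quat_add0 : left_id quat_zero quat_add.
Proof. by case=> ? ? ? ?; congr Quat; apply: add0r. Qed.
Fact quat_addN : left_inverse quat_zero quat_opp quat_add.
Proof. by case=> ? ? ? ?; congr Quat; apply: addNr. Qed.

HB.instance Definition _ :=
  GRing.isZmodule.Build H quat_addA quat_addC quat_add0 quat_addN.

Fact quat_mulA : associative quat_mul.
Proof. by case=> ? ? ? ? [? ? ? ?] [? ? ? ?]; congr Quat; ring. Qed.
Fact quat_mul1l : left_id quat_one quat_mul.
Proof. by case=> ? ? ? ?; congr Quat; ring. Qed.
Fact quat_mul1r : right_id quat_one quat_mul.
Proof. by case=> ? ? ? ?; congr Quat; ring. Qed.
Fact quat_mulDl : left_distributive quat_mul quat_add.
Proof. by case=> ? ? ? ? [? ? ? ?] [? ? ? ?]; congr Quat => /=; ring. Qed.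
Fact quat_mulDr : right_distributive quat_mul quat_add.
Proof. by case=> ? ? ? ? [? ? ? ?] [? ? ? ?]; congr Quat => /=; ring. Qed.
Fact quat_one_neq0 : quat_one != quat_zero.
Proof. by apply/eqP => -[] /eqP; rewrite oner_eq0. Qed.

HB.instance Definition _ := GRing.Zmodule_isNzRing.Build H
  quat_mulA quat_mul1l quat_mul1r quat_mulDl quat_mulDr quat_one_neq0.

Fact quat_scaleA a b p : quat_scale a (quat_scale b p) = quat_scale (a * b) p.
Proof. by case: p => ? ? ? ?; congr Quat; apply: mulrA. Qed.
Fact quat_scale1 : left_id 1 quat_scale.
Proof. by case=> ? ? ? ?; congr Quat; apply: mul1r. Qed.
Fact quat_scaleDr : right_distributive quat_scale +%R.
Proof. by move=> ? [? ? ? ?] [? ? ? ?]; congr Quat; apply: mulrDr. Qed.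
Fact quat_scaleDl p : {morph quat_scale^~ p : a b / a + b}.
Proof. by case: p => ? ? ? ? a b; congr Quat; apply: mulrDl. Qed.

HB.instance Definition _ := GRing.Zmodule_isLmodule.Build R H
  quat_scaleA quat_scale1 quat_scaleDr quat_scaleDl.

Definition qi : H := Quat 0 1 0 0.
Definition qj : H := Quat 0 0 1 0.
Definition qk : H := Quat 0 0 0 1.

Definition qconj p : H := Quat (qre p) (- qim1 p) (- qim2 p) (- qim3 p).

End QuatAlgebra.

Arguments qi {R}.
Arguments qj {R}.
Arguments qk {R}.

Section QuatPlane.
Variable R : rcfType.
Local Notation H := (quat R).
Local Notation H2 := (quat R * quat R)%type.

Definition qabs (q : H) : R :=
  Num.sqrt (qre q ^+ 2 + qim1 q ^+ 2 + qim2 q ^+ 2 + qim3 q ^+ 2).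

Definition hdot (xi eta : H2) : H :=
  xi.1 * qconj eta.1 + xi.2 * qconj eta.2.

Definition hnorm2 (xi : H2) : R := qabs xi.1 ^+ 2 + qabs xi.2 ^+ 2.

Fact qabs_sq (q : H) :
  qabs q ^+ 2 = qre q ^+ 2 + qim1 q ^+ 2 + qim2 q ^+ 2 + qim3 q ^+ 2.
Proof. by rewrite sqr_sqrtr// !addr_ge0 ?sqr_ge0. Qed.

Fact hdotxx (xi : H2) : hdot xi xi = hnorm2 xi *: (1 : H).
Proof.
rewrite /hnorm2 !qabs_sq.
by case: xi => -[? ? ? ?] [? ? ? ?]; congr Quat => /=; ring.
Qed.

Definition fnG (P : H2 * H2) : R :=
  Num.sqrt (hnorm2 P.1 * hnorm2 P.2 - qabs (hdot P.1 P.2) ^+ 2).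

(* The radicand of fnG is nonnegative, so that Num.sqrt, which is 0 on
   negative numbers, is a genuine square root there. *)
Fact hdot_CauchySchwarz (xi eta : H2) :
  0 <= hnorm2 xi * hnorm2 eta - qabs (hdot xi eta) ^+ 2.
Proof.
have key : qabs xi.1 ^+ 2 *
      (hnorm2 xi * hnorm2 eta - qabs (hdot xi eta) ^+ 2) =
    qabs ((qabs xi.1 ^+ 2) *: eta.2 - eta.1 * qconj xi.1 * xi.2) ^+ 2.
  rewrite /hnorm2 !qabs_sq /hdot.
  by case: xi eta => -[? ? ? ?] [? ? ? ?] [[? ? ? ?] [? ? ? ?]] /=; ring.
have [a0|a_gt0] := eqVneq (qabs xi.1) 0; last first.
  by rewrite -(pmulr_rge0 _ (_ : 0 < qabs xi.1 ^+ 2)) ?key ?sqr_ge0//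
             exprn_even_gt0.
have : xi.1 = 0.
  have : qabs xi.1 ^+ 2 = 0 by rewrite a0 expr0n.
  rewrite qabs_sq; case: xi.1 => a b c d /= /eqP.
  rewrite !paddr_eq0 ?(addr_ge0, sqr_ge0)// !sqrf_eq0.
  by move=> /andP[/andP[/andP[/eqP-> /eqP->] /eqP->] /eqP->].
case: xi eta {key a0} => -[a b c d] [i j k l] [[e f g h] [? ? ? ?]].
rewrite /hnorm2 !qabs_sq /hdot /= => -[-> -> -> ->].
rewrite [leRHS](_ : _ = (i ^+ 2 + j ^+ 2 + k ^+ 2 + l ^+ 2)
  * (e ^+ 2 + f ^+ 2 + g ^+ 2 + h ^+ 2)); last by ring.
by rewrite mulr_ge0// !addr_ge0 ?sqr_ge0.
Qed.

Definition he1 : H2 := (1, 0).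
Definition he2 : H2 := (0, 1).
Definition I2 : H2 * H2 := (he1, he2).

(* S(r, s, t) = (- s j - t k, r i + t k). *)
Definition opS (v : 'cV[R]_3) : H2 :=
  let r := v 0 0 in let s := v 1 0 in let t := v 2 0 in
  (- (s *: qj) - t *: qk, r *: qi + t *: qk).

Definition fnF (A : 'M[R]_(3, 2)) : R :=
  fnG (he1 + opS (col 0 A), he2 + opS (col 1 A)).

End QuatPlane.

Arguments he1 {R}.
Arguments he2 {R}.
Arguments I2 {R}.

Section Calculus.
Variable R : realType.
Implicit Types (m : nat) (W : normedModType R).

Definition axis (j : 'I_2) : R * R := if j == 0 then (1, 0) else (0, 1).

Definition partial W (j : 'I_2) (f : R * R -> W) : R * R -> W :=
  'D_(axis j) f.

Fixpoint Ck W (k : nat) (f : R * R -> W) : Prop :=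
  continuous f /\
  if k is k'.+1 then
    forall j, (forall x, derivable f x (axis j)) /\ Ck k' (partial j f)
  else True.

(* Functions on the torus are functions on the plane that are 2pi-periodic in
   each variable. *)
Definition torus_periodic (T : Type) (f : R * R -> T) :=
  forall x : R * R,
    f (x.1 + 2 * pi, x.2) = f x /\ f (x.1, x.2 + 2 * pi) = f x.

Definition Cinfty_torus W (f : R * R -> W) :=
  torus_periodic f /\ forall k, Ck k f.

Definition torus_cell : set (R * R) := `[0, 2 * pi[ `*` `[0, 2 * pi[.

Local Notation lebesgue2 := (@lebesgue_measure R \x @lebesgue_measure R)%E.

Definition torus_int (f : R * R -> R) : R :=
  \int[lebesgue2]_(x in torus_cell) f x.

Definition torus_avg (f : R * R -> R) : R :=
  (fine (lebesgue2 torus_cell))^-1 * torus_int f.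

Definition grad m (phi : R * R -> 'cV[R]_m) (x : R * R) : 'M[R]_(m, 2) :=
  \matrix_(i, j) partial j phi x i 0.

Definition locally_lipschitz m n (F : 'M[R]_(m, n) -> R) :=
  forall A : 'M[R]_(m, n), exists2 U, nbhs A U & [lipschitz F B | B in U].

(* Meant for locally Lipschitz F, for which the integrand is bounded and
   continuous on the torus. *)
Definition quasiconvex_at m (F : 'M[R]_(m, 2) -> R) (A : 'M[R]_(m, 2)) :=
  forall phi : R * R -> 'cV[R]_m, Cinfty_torus phi ->
    0 <= torus_int (fun x => F (A + grad phi x) - F A).

Definition rank_one_convex m n (F : 'M[R]_(m, n) -> R) :=
  forall A X : 'M[R]_(m, n), \rank X = 1%N ->
    convex_function [set: R] (fun t : R => F (A + t *: X)).

(* D(S phi), as the pair of its two columns in H^2. *)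
Definition DS (phi : R * R -> 'cV[R]_3) (x : R * R) :
    (quat R * quat R) * (quat R * quat R) :=
  (opS (partial 0 phi x), opS (partial 1 phi x)).

Definition phiS (x : R * R) : 'cV[R]_3 :=
  sin x.1 *: delta_mx 0 0 + sin x.2 *: delta_mx 1 0
    + sin (x.1 + x.2) *: delta_mx 2 0.

End Calculus.

(* Main.v *)
Require Import Defs.
From mathcomp Require Import all_boot all_order all_algebra.
From mathcomp Require Import ring lra.
From mathcomp Require Import all_classical all_reals all_analysis.
From mathcomp Require Import measurable_realfun.

Import Order.TTheory GRing.Theory Num.Theory.
Import numFieldNormedType.Exports.

Local Open Scope classical_set_scope.
Local Open Scope ring_scope.

(** For x, y in H^2 the radicand of G is the Gram determinant
    [gram x y = |x|^2 |y|^2 - |<x, y>|^2], which is nonnegative and behaves like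
    the square of an area: along a real rank-one direction,
    t |-> (x + t a u, y + t b u), it is a polynomial in t of degree at most two,
    with leading coefficient [gram (b x - a y) u] ([gram_rank_one]).  The square
    root of a nonnegative quadratic is convex, which is rank-one convexity of F
    since S is real-linear; it moreover has slope at most the square root of the
    leading coefficient, and moving the two columns one after the other then
    shows that F is locally Lipschitz.

    Along the map of the theorem, with a = cos x1, b = cos x2 and
    c = cos (x1 + x2), the radicand is
      1 + a^2 b^2 + a^2 c^2 + b^2 c^2 - 4 a b c                 ([gram_phiS]),
    and expanding in characters cos (m x1 + n x2) shows that its mean is 3/4
    ([radicand_trig_poly]): each of the three products has mean 1/4 and so has
    a b c.  Since the square root is concave, the mean of G is at most
    sqrt (3/4) = sqrt 3 / 2 ([torus_int_sqrt_radicand]); the bound is obtained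
    by integrating the tangent line of the square root at 3/4.  As F 0 = 1, the
    map itself violates quasiconvexity at 0. *)

(** * Square roots of nonnegative quadratics *)

Section NonnegativeQuadratic.
Variable R : rcfType.
Variables a b c : R.
Local Notation q t := (a * t ^+ 2 + 2 * b * t + c).
Hypothesis q_ge0 : forall t, 0 <= q t.

Lemma nneg_quadratic_discr : b ^+ 2 <= a * c.
Proof.
pose p := Poly [:: c; 2 * b; a].
have /deg_le2_poly_ge0 : (size p <= 3)%N by rewrite size_Poly.
rewrite !coefE /= exprMn => h; suff : 2 ^+ 2 * b ^+ 2 - 4 * a * c <= 0 by lra.
apply: h => t; rewrite horner_Poly /= (_ : _ + c = q t) //; ring.
Qed.

(** The left-hand side is the polarization of q; this is the Cauchy-Schwarz
    inequality of the form obtained by homogenizing q, since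
    q s * q t - polar^2 = (ac - b^2) (s - t)^2. *)
Lemma nneg_quadratic_polar s t :
  a * s * t + b * (s + t) + c <= Num.sqrt (q s) * Num.sqrt (q t).
Proof.
rewrite -sqrtrM// (le_trans (ler_norm _))// -sqrtr_sqr ler_sqrt.
  rewrite -subr_ge0.
  have -> : q s * q t - (a * s * t + b * (s + t) + c) ^+ 2
            = (a * c - b ^+ 2) * (s - t) ^+ 2 by ring.
  by rewrite mulr_ge0 ?sqr_ge0// subr_ge0 nneg_quadratic_discr.
by rewrite mulr_ge0.
Qed.

(** After squaring, the difference of the two sides is
    2 k (1 - k) (sqrt (q s) sqrt (q t) - polar). *)
Lemma sqrt_nneg_quadratic_convex (k s t : R) : 0 <= k <= 1 ->
  Num.sqrt (q (k * s + (1 - k) * t))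
    <= k * Num.sqrt (q s) + (1 - k) * Num.sqrt (q t).
Proof.
case/andP=> k0 k1; have k'0 : 0 <= 1 - k by rewrite subr_ge0.
set S := Num.sqrt (q s); set T := Num.sqrt (q t).
have rhs0 : 0 <= k * S + (1 - k) * T by rewrite addr_ge0// mulr_ge0// sqrtr_ge0.
rewrite -(ler_pXn2r (ltn0Sn 1)) ?nnegrE ?sqrtr_ge0// sqr_sqrtr// -subr_ge0.
have -> : (k * S + (1 - k) * T) ^+ 2 - q (k * s + (1 - k) * t)
   = k ^+ 2 * (S ^+ 2 - q s) + (1 - k) ^+ 2 * (T ^+ 2 - q t)
     + 2 * k * (1 - k) * (S * T - (a * s * t + b * (s + t) + c)) by ring.
rewrite /S /T !sqr_sqrtr// !subrr !mulr0 !add0r mulr_ge0 ?subr_ge0//.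
  by rewrite !mulr_ge0.
exact: nneg_quadratic_polar.
Qed.

(** The homogenization of q is the square of a seminorm on the plane, and this
    is its triangle inequality: the discriminant bound
    |b| <= sqrt a sqrt c puts q 1 between (sqrt c - sqrt a)^2 and
    (sqrt c + sqrt a)^2. *)
Lemma sqrt_nneg_quadratic_dist (a_ge0 : 0 <= a) :
  `|Num.sqrt (q 1) - Num.sqrt (q 0)| <= Num.sqrt a.
Proof.
have := nneg_quadratic_discr; have := q_ge0 1; have := q_ge0 0.
rewrite !expr1n expr0n /= !mulr0 !mulr1 !add0r => c0 q1 bac.
have bl : `|b| <= Num.sqrt a * Num.sqrt c.
  by rewrite -sqrtrM// -sqrtr_sqr ler_sqrt// mulr_ge0.
have := sqr_sqrtr a_ge0; have := sqr_sqrtr c0; have := sqr_sqrtr q1.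
move: bl (sqrtr_ge0 a) (sqrtr_ge0 c) (sqrtr_ge0 (a + 2 * b + c)).
set A := Num.sqrt a; set C := Num.sqrt c; set Q := Num.sqrt _.
rewrite ler_norml => /andP[b1 b2] A0 C0 Q0 QE CE AE.
have Qle : Q <= A + C by rewrite -(ler_pXn2r (ltn0Sn 1)) ?nnegrE ?addr_ge0//; nra.
have Cle : C <= A + Q.
  have [|/ltW CA] := leP C A; first by lra.
  suff : C - A <= Q by lra.
  by rewrite -(ler_pXn2r (ltn0Sn 1)) ?nnegrE ?subr_ge0//; nra.
by rewrite ler_distl; apply/andP; split; lra.
Qed.

End NonnegativeQuadratic.
Arguments sqrt_nneg_quadratic_convex {R a b c}.
Arguments sqrt_nneg_quadratic_dist {R a b c}.

(** * The quaternionic Gram determinant on rank-one lines *)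

Section QuaternionGram.
Variable R : rcfType.
Local Notation H := (quat R).
Local Notation H2 := (H * H)%type.
Implicit Types (x y u : H2) (s t a b : R) (p : H).

Lemma hnorm2_ge0 x : 0 <= hnorm2 x.
Proof. by rewrite addr_ge0// sqr_ge0. Qed.

Lemma hnorm2_line x u s :
  hnorm2 (x + s *: u)
  = hnorm2 x + 2 * s * qre (hdot x u) + s ^+ 2 * hnorm2 u.
Proof.
rewrite /hnorm2 /hdot !qabs_sq.
by case: x u => -[? ? ? ?] [? ? ? ?] [[? ? ? ?] [? ? ? ?]] /=; ring.
Qed.

Lemma hdot_line x y u s t :
  hdot (x + s *: u) (y + t *: u)
  = hdot x y + t *: hdot x u + s *: qconj (hdot y u)
    + (s * t * hnorm2 u) *: (1 : H).
Proof.
rewrite /hnorm2 /hdot !qabs_sq.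
case: x y u => -[? ? ? ?] [? ? ? ?] [[? ? ? ?] [? ? ? ?]] [[? ? ? ?] [? ? ? ?]].
by congr Quat => /=; ring.
Qed.

Definition gram x y : R := hnorm2 x * hnorm2 y - qabs (hdot x y) ^+ 2.

Lemma fnGE x y : fnG (x, y) = Num.sqrt (gram x y). Proof. by []. Qed.

Lemma gram_ge0 x y : 0 <= gram x y. Proof. exact: hdot_CauchySchwarz. Qed.

Lemma gram_le x y : gram x y <= hnorm2 x * hnorm2 y.
Proof. by rewrite gerBl sqr_ge0. Qed.

Lemma hdot_lincombl x y u a b :
  hdot (b *: x - a *: y) u = b *: hdot x u - a *: hdot y u.
Proof.
case: x y u => -[? ? ? ?] [? ? ? ?] [[? ? ? ?] [? ? ? ?]] [[? ? ? ?] [? ? ? ?]].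
by congr Quat => /=; ring.
Qed.

Lemma hnorm2_lincomb x y a b :
  hnorm2 (b *: x - a *: y)
  = b ^+ 2 * hnorm2 x - 2 * a * b * qre (hdot x y) + a ^+ 2 * hnorm2 y.
Proof.
rewrite /hnorm2 /hdot !qabs_sq.
by case: x y => -[? ? ? ?] [? ? ? ?] [[? ? ? ?] [? ? ? ?]] /=; ring.
Qed.

(** The terms of degree 3 and 4 cancel because the direction (a u, b u) has real
    rank one.  If a^2 + b^2 = 1, the rotation (x, y) |-> (b x - a y, a x + b y)
    preserves gram and turns the direction into (0, u), which explains the
    leading coefficient.  Its being a Gram determinant again gives the size of
    the Lipschitz constant. *)
Lemma gram_rank_one x y u a b : exists c, forall t,
  gram (x + (t * a) *: u) (y + (t * b) *: u)
  = gram (b *: x - a *: y) u * t ^+ 2 + 2 * c * t + gram x y.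
Proof.
rewrite /gram.
(* With z = <x,y>, p = <x,u>, r = <y,u>, the increment of <x,y> to first order
   in t is b p + a (qconj r); c is half the derivative of the determinant at
   t = 0. *)
exists (a * qre (hdot x u) * hnorm2 y + b * qre (hdot y u) * hnorm2 x
  - (qre (hdot x y) * (b * qre (hdot x u) + a * qre (hdot y u))
     + qim1 (hdot x y) * (b * qim1 (hdot x u) - a * qim1 (hdot y u))
     + qim2 (hdot x y) * (b * qim2 (hdot x u) - a * qim2 (hdot y u))
     + qim3 (hdot x y) * (b * qim3 (hdot x u) - a * qim3 (hdot y u)))) => t.
rewrite !hnorm2_line hdot_line hdot_lincombl hnorm2_lincomb !qabs_sq.
move: (hnorm2 x) (hnorm2 y) (hnorm2 u) (hdot x y) (hdot x u) (hdot y u).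
by move=> ? ? ? [? ? ? ?] [? ? ? ?] [? ? ? ?] /=; ring.
Qed.

Lemma fnG_rank_one_convex x y u a b k s t :
  let g r := fnG (x + (r * a) *: u, y + (r * b) *: u) in
  0 <= k <= 1 -> g (k * s + (1 - k) * t) <= k * g s + (1 - k) * g t.
Proof.
move=> g k01; have [c gE] := gram_rank_one x y u a b.
rewrite /g !fnGE !gE; apply: sqrt_nneg_quadratic_convex => // r.
by rewrite -gE gram_ge0.
Qed.

Lemma fnG_rank_one_dist x y u a b :
  `|fnG (x + a *: u, y + b *: u) - fnG (x, y)|
    <= Num.sqrt (hnorm2 (b *: x - a *: y)) * Num.sqrt (hnorm2 u).
Proof.
have [c gE] := gram_rank_one x y u a b.
have h t : 0 <= gram (b *: x - a *: y) u * t ^+ 2 + 2 * c * t + gram x y.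
  by rewrite -gE gram_ge0.
have := sqrt_nneg_quadratic_dist h (gram_ge0 _ _).
rewrite -!gE -!fnGE !mul1r !mul0r !scale0r !addr0 => /le_trans; apply.
by rewrite -sqrtrM ?hnorm2_ge0// ler_wsqrtr// gram_le.
Qed.

End QuaternionGram.
Arguments gram {R}.

(** * Rank-one convexity and local Lipschitz continuity of F *)

Lemma rank1_colrow (F : fieldType) m n (X : 'M[F]_(m, n)) :
  \rank X = 1%N -> exists (u : 'cV[F]_m) (w : 'rV[F]_n), X = u *m w.
Proof.
move=> rX; have := mulmx_base X.
move: (col_base X) (row_base X); rewrite rX => u w <-.
by exists u, w.
Qed.

Lemma mx_entry_le (K : realDomainType) m n (X : 'M[K]_(m, n)) i j :
  `|X i j| <= `|X|.
Proof.
rewrite [leRHS]mx_normrE.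
by rewrite (le_bigmax_cond _ (fun ij => `|X ij.1 ij.2|) (j := (i, j))).
Qed.

Section Integrand.
Variable R : realType.
Local Notation H2 := (quat R * quat R)%type.
Implicit Types (u v : 'cV[R]_3) (A B : 'M[R]_(3, 2)) (x y : H2).

Lemma opSD u v : opS (u + v) = opS u + opS v.
Proof. by rewrite /opS !mxE; congr pair; congr Quat => /=; ring. Qed.

Lemma opSZ a v : opS (a *: v) = a *: opS v.
Proof. by rewrite /opS !mxE; congr pair; congr Quat => /=; ring. Qed.

Lemma fnF_rank_one_convex : rank_one_convex (@fnF R).
Proof.
move=> A X /rank1_colrow[u [w ->]] k s t _ _.
have colE j r : opS (col j (A + r *: (u *m w)))
    = opS (col j A) + (r * w 0 j) *: opS u.
  rewrite -opSZ -opSD; congr opS.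
  by apply/colP => i; rewrite !mxE big_ord1; ring.
rewrite /fnF !colE !addrA; apply: fnG_rank_one_convex.
by rewrite ge0 le1.
Qed.

Lemma hnorm2_opS v : hnorm2 (opS v) <= (2 * `|v|) ^+ 2.
Proof.
rewrite /hnorm2 !qabs_sq /opS /=.
have h i : v i 0 ^+ 2 <= `|v| ^+ 2.
  by rewrite -real_normK ?num_real// lerXn2r ?nnegrE// mx_entry_le.
have := h 0; have := h 1; have := h 2; rewrite exprMn.
rewrite !mulr0 !mulr1 !oppr0 !(add0r, addr0, subr0, sub0r) !expr0n /=; lra.
Qed.

Lemma hnorm2D_le x y : hnorm2 (x + y) <= 2 * (hnorm2 x + hnorm2 y).
Proof.
have -> : 2 * (hnorm2 x + hnorm2 y) = hnorm2 (x + y) + hnorm2 (x - y); last first.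
  by rewrite lerDl hnorm2_ge0.
rewrite /hnorm2 !qabs_sq.
by case: x y => -[? ? ? ?] [? ? ? ?] [[? ? ? ?] [? ? ? ?]] /=; ring.
Qed.

(** On the unit ball around A the columns he + S B_j are bounded by some K, so
    replacing the second column and then the first changes F by at most
    2 K |B - B'| each time. *)
Lemma fnF_locally_lipschitz : locally_lipschitz (@fnF R).
Proof.
move=> A; exists (ball A 1); first exact: nbhsx_ballx.
pose M := `|A| + 1; pose K := Num.sqrt (2 * (1 + (2 * M) ^+ 2)).
have col_le j (B : 'M[R]_(3, 2)) : `|col j B| <= `|B|.
  rewrite [leLHS]mx_normrE; apply: bigmax_le => // -[i k] _ /=.
  by rewrite mxE mx_entry_le.
have ballM B : ball A 1 B -> `|B| <= M.
  rewrite mx_norm_ball /ball_ /= /M => AB.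
  by rewrite -(subrK A B) addrC (le_trans (ler_normD _ _))// lerD2l distrC ltW.
have KP e B j : hnorm2 e = 1 -> ball A 1 B ->
    Num.sqrt (hnorm2 (e + opS (col j B))) <= K.
  move=> e1 /ballM BM; apply/ler_wsqrtr/(le_trans (hnorm2D_le _ _)).
  rewrite ler_pM2l// e1 lerD2l (le_trans (hnorm2_opS _))// lerXn2r ?nnegrE//.
    by rewrite mulr_ge0// (le_trans _ BM).
  by rewrite ler_pM2l// (le_trans _ BM).
have dP j (B B' : 'M[R]_(3, 2)) :
    Num.sqrt (hnorm2 (opS (col j (B - B')))) <= 2 * `|B - B'|.
  rewrite (le_trans (ler_wsqrtr (hnorm2_opS _)))// sqrtr_sqr ger0_norm//.
  by rewrite ler_pM2l.
have colB j (B B' : 'M[R]_(3, 2)) :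
    opS (col j B) = opS (col j B') + opS (col j (B - B')).
  by rewrite -opSD; congr opS; apply/colP => i; rewrite !mxE; ring.
have he1n : hnorm2 (he1 : H2) = 1 by rewrite /hnorm2 !qabs_sq /=; ring.
have he2n : hnorm2 (he2 : H2) = 1 by rewrite /hnorm2 !qabs_sq /=; ring.
have PF : ProperFilter (globally (ball A 1 `*` ball A 1)).
  by apply: (@globally_properfilter _ _ (A, A)); split; exact: ballxx.
apply: (@klipschitzW _ _ _ (4 * K)) => -[B B'] [/= AB AB'].
rewrite /fnF; set x := he1 + _; set y := he2 + _.
set x' := he1 + _; set y' := he2 + _.
have yE : y = y' + 1 *: opS (col 1 (B - B')).
  by rewrite scale1r /y (colB 1 B B') addrA.
have xE : x = x' + 1 *: opS (col 0 (B - B')).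
  by rewrite scale1r /x (colB 0 B B') addrA.
have step1 : `|fnG (x, y) - fnG (x, y')| <= K * (2 * `|B - B'|).
  have := fnG_rank_one_dist _ x y' (opS (col 1 (B - B'))) 0 1.
  rewrite -yE !scale0r addr0 scale1r subr0 => /le_trans; apply.
  by rewrite ler_pM ?sqrtr_ge0// KP.
have step2 : `|fnG (x, y') - fnG (x', y')| <= K * (2 * `|B - B'|).
  have := fnG_rank_one_dist _ x' y' (opS (col 0 (B - B'))) 1 0.
  rewrite -xE !scale0r addr0 scale1r sub0r.
  have -> : hnorm2 (- y') = hnorm2 y'.
    rewrite /hnorm2 !qabs_sq.
    by case: (y') => -[? ? ? ?] [? ? ? ?] /=; ring.
  move=> /le_trans; apply.
  by rewrite ler_pM ?sqrtr_ge0// KP.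
rewrite (le_trans (ler_distD (fnG (x, y')) _ _))//.
rewrite (_ : 4 * K * _ = K * (2 * `|B - B'|) + K * (2 * `|B - B'|)) ?lerD//.
by ring.
Qed.

End Integrand.

(** * Smoothness of plane waves *)

Section TrigonometricWaves.
Variables (R : realType) (W : normedModType R).
Implicit Types (f g : R * R -> W) (a b s : R) (w : W) (x : R * R).

(** A phase s is included so that the family is closed under differentiation:
    the derivative of sine is sine shifted by pi / 2.  This makes smoothness of
    all orders a plain induction. *)
Definition wave a b s w x : W := sin (a * x.1 + b * x.2 + s) *: w.

Lemma wave_continuous a b s w : continuous (wave a b s w).
Proof.
move=> x; apply: cvgZr_tmp; apply: continuous_comp; last exact: continuous_sin.
apply: cvgD; last exact: cvg_cst.
have cfst : fst @ x --> x.1 by exact: cvg_fst.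
have csnd : snd @ x --> x.2 by exact: cvg_snd.
by apply: cvgD; apply: cvgMl_tmp; [exact: cfst|exact: csnd].
Qed.

Lemma is_derive_line f x e (d : W) :
  is_derive (0 : R) (1 : R) (fun h : R => f (h *: e + x)) d -> is_derive x e f d.
Proof.
move=> [df1 df2]; split; first exact/derivable1P.
rewrite -df2 /derive; set g1 := fun h => h^-1 *: _; set g2 := fun h => h^-1 *: _.
suff -> : g1 = g2 by [].
apply/funext => h; rewrite /g1 /g2 /=.
by rewrite addr0 scale0r add0r [_%:A]mulr1.
Qed.

Lemma is_derive_scalel (f : R -> R) (t d : R) w :
  is_derive t 1 f d -> is_derive t 1 (fun h => f h *: w) (d *: w).
Proof.
move=> [df1 df2].
have cv : (fun h =>
      h^-1 *: (((fun r => f r *: w) \o shift t) (h *: 1) - f t *: w))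
    @ 0^' --> d *: w.
  rewrite [X in X @ _](_ : _ =
      fun h => (h^-1 *: ((f \o shift t) (h *: 1) - f t)) *: w).
    by rewrite -df2; apply: cvgZr_tmp; exact: df1.
  by apply/funext => h /=; rewrite -scalerBl scalerA.
split; first by apply/cvg_ex; exists (d *: w).
exact: cvg_lim.
Qed.

Lemma is_derive_wave a b s w x (j : 'I_2) :
  is_derive x (axis R j) (wave a b s w)
    (wave a b (s + pi / 2) ((if j == 0 then a else b) *: w) x).
Proof.
apply: is_derive_line; rewrite /wave scalerA addrA sinDpihalf.
apply: is_derive_scalel; set c := if _ then a else b.
rewrite [X in is_derive _ _ X](_ : _ =
    sin \o (fun h : R => h * c + (a * x.1 + b * x.2 + s))); last first.
  apply/funext => h; rewrite /c /=; congr sin.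
  (* On R, scaling is multiplication only up to conversion. *)
  change (a * (h * (axis R j).1 + x.1) + b * (h * (axis R j).2 + x.2) + s =
    h * (if j == 0 then a else b) + (a * x.1 + b * x.2 + s)).
  by rewrite /axis; case: eqP => _ /=; ring.
have := @is_derive1_comp _ sin (fun h : R => h * c + (a * x.1 + b * x.2 + s)) 0.
rewrite mul0r add0r; apply.
by apply: is_derive_eq; rewrite scaler0 add0r [_%:A]mulr1 addr0.
Qed.

Lemma partial_wave a b s w (j : 'I_2) :
  partial j (wave a b s w)
  = wave a b (s + pi / 2) ((if j == 0 then a else b) *: w).
Proof.
by apply/funext => x; have [_] := is_derive_wave a b s w x j.
Qed.

Lemma wave_Ck k a b s w : Ck k (wave a b s w).
Proof.
elim: k s w => [|k IHk] s w /=; split=> //; try exact: wave_continuous.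
move=> j; split; first by move=> x; have [] := is_derive_wave a b s w x j.
by rewrite partial_wave.
Qed.

Lemma partialD f g (j : 'I_2) :
  (forall x, derivable f x (axis R j)) -> (forall x, derivable g x (axis R j)) ->
  partial j (f + g) = partial j f + partial j g.
Proof. by move=> df dg; apply/funext => x; exact: deriveD. Qed.

Lemma CkD k f g : Ck k f -> Ck k g -> Ck k (f + g).
Proof.
elim: k f g => [|k IHk] f g /= [cf df] [cg dg]; split=> //;
  try by move=> x; apply: cvgD; [exact: cf|exact: cg].
move=> j; have [dfj Cfj] := df j; have [dgj Cgj] := dg j.
split; first by move=> x; exact: derivableD.
by rewrite partialD//; exact: IHk.
Qed.

End TrigonometricWaves.
Arguments wave {R W}.

(** * The integrand along the map of the theorem *)

Section Phi.
Variable R : realType.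

Lemma phiS_waves : @phiS R =
  wave 1 0 0 (delta_mx 0 0) + wave 0 1 0 (delta_mx 1 0)
    + wave 1 1 0 (delta_mx 2 0).
Proof.
apply/funext => x; rewrite /phiS !fctE /wave.
by rewrite !mul1r !mul0r !addr0 !add0r.
Qed.

Lemma phiS_Cinfty : Cinfty_torus (@phiS R).
Proof.
split=> [x|k]; last by rewrite phiS_waves; do 2?apply: CkD; exact: wave_Ck.
split; rewrite /phiS /= mulr_natl sinD2pi.
  by rewrite (addrAC x.1) sinD2pi.
by rewrite (addrA x.1 x.2 (pi *+ 2)) sinD2pi.
Qed.

Lemma partial_phiS (j : 'I_2) (x : R * R) : partial j (@phiS R) x =
  if j == 0 then cos x.1 *: delta_mx 0 0 + cos (x.1 + x.2) *: delta_mx 2 0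
  else cos x.2 *: delta_mx 1 0 + cos (x.1 + x.2) *: delta_mx 2 0.
Proof.
have dw a b s w y : derivable (wave a b s (w : 'cV[R]_3)) y (axis R j).
  by have [] := is_derive_wave _ _ a b s w y j.
have dw2 a b s w a' b' s' w' y :
    derivable (wave a b s (w : 'cV[R]_3) + wave a' b' s' w') y (axis R j).
  by apply: derivableD; exact: dw.
rewrite phiS_waves partialD; [|move=> y; exact: dw2|move=> y; exact: dw].
rewrite partialD; [|move=> y; exact: dw|move=> y; exact: dw].
rewrite !partial_wave !fctE /wave.
case: eqP => _;
  rewrite !(scale1r, scale0r, scaler0, mul1r, mul0r, add0r, addr0);
  by rewrite !sinDpihalf.
Qed.

Lemma fnF_grad (x : R * R) : fnF (grad (@phiS R) x) = fnG (I2 + DS (@phiS R) x).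
Proof.
have colE j : col j (grad (@phiS R) x) = partial j (@phiS R) x.
  by apply/colP => i; rewrite !mxE.
by rewrite /fnF !colE.
Qed.

Definition radicand (x : R * R) : R :=
  let a := cos x.1 in let b := cos x.2 in let c := cos (x.1 + x.2) in
  1 + a ^+ 2 * b ^+ 2 + a ^+ 2 * c ^+ 2 + b ^+ 2 * c ^+ 2 - 4 * a * b * c.

(** Here the two columns are (1 - c k, a i + c k) and (- b j - c k, 1 + c k),
    whose product is 2 c^2 + (a + b c) i + (b + a c) j + 2 c k. *)
Lemma gram_phiS (x : R * R) :
  gram (I2 + DS (@phiS R) x).1 (I2 + DS (@phiS R) x).2 = radicand x.
Proof.
rewrite /gram /DS !partial_phiS /hnorm2 !qabs_sq /hdot /= !mxE /=.
by rewrite /radicand; ring.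
Qed.

Lemma fnG_phiS (x : R * R) : fnG (I2 + DS (@phiS R) x) = Num.sqrt (radicand x).
Proof. by rewrite -gram_phiS. Qed.

Lemma radicand_ge0 (x : R * R) : 0 <= radicand x.
Proof. by rewrite -gram_phiS gram_ge0. Qed.

End Phi.
Arguments radicand {R}.

(** * Integrals of characters over the torus *)

Section TorusIntegrals.
Variable R : realType.
Local Notation mu := (@lebesgue_measure R).
Local Notation mu2 := (mu \x mu)%E.
Local Notation cell := (@torus_cell R).
Implicit Types (f g : R * R -> R) (m n : int).

Lemma measurable_cell : measurable cell.
Proof. by apply: measurableX; exact: measurable_itv. Qed.

Lemma two_pi_gt0 : 0 < 2 * pi :> R.
Proof. by rewrite mulr_gt0// pi_gt0. Qed.

Lemma mu_cell : mu2 cell = ((2 * pi) ^+ 2)%:E.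
Proof.
have side : mu `[0, 2 * pi[%classic = (2 * pi)%:E.
  by rewrite lebesgue_measure_itv /= lte_fin two_pi_gt0 oppr0 adde0.
transitivity (mu `[0%R, (2 * pi)%R[%classic * mu `[0%R, (2 * pi)%R[%classic)%E.
  by apply: product_measure1E; exact: measurable_itv.
by rewrite side -EFinM.
Qed.

Lemma mu_cell_lty : (mu2 cell < +oo)%E.
Proof. by rewrite mu_cell ltry. Qed.

Lemma bounded_torus_integrable f (M : R) : measurable_fun setT f ->
  (forall x, `|f x| <= M) -> mu2.-integrable cell (EFin \o f).
Proof.
move=> mf fM; apply: measurable_bounded_integrable.
- exact: measurable_cell.
- exact: mu_cell_lty.
- exact: measurable_funTS.
- exists M; split; first exact: num_real.
  by move=> K MK x _; exact: le_trans (fM x) (ltW MK).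
Qed.

(** Real parts of the characters of the torus. *)
Definition character m n (x : R * R) : R := cos (m%:~R * x.1 + n%:~R * x.2).

Lemma measurable_character m n : measurable_fun setT (character m n).
Proof.
apply: measurableT_comp.
  by apply: continuous_measurable_fun; exact: continuous_cos.
by apply: measurable_funD; apply: measurable_funM => //.
Qed.

Lemma integrable_character m n : mu2.-integrable cell (EFin \o character m n).
Proof.
apply: (@bounded_torus_integrable _ 1); first exact: measurable_character.
by move=> x; exact: cos_max.
Qed.

Lemma sinDint2pi n s : sin (s + n%:~R * (2 * pi)) = sin s :> R.
Proof.
have E k (t : R) : sin (t + k%:R * (2 * pi)) = sin t.
  by rewrite mulrA -natrM mulr_natl mulnC mulrnA (periodicn (@sinD2pi R)).
case: n => k; first exact: E.
rewrite -(E k.+1); congr sin; rewrite NegzE mulrNz -pmulrn.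
by rewrite mulNr subrK.
Qed.

Lemma integral_cos_period (s : R) n : n != 0 ->
  (\int[mu]_(y in `[0%R, (2 * pi)%R[) (cos (s + n%:~R * y))%:E = 0)%E.
Proof.
move=> n0; have nR0 : n%:~R != 0 :> R by rewrite intr_eq0.
have cc : continuous (fun y : R => cos (s + n%:~R * y)).
  move=> y; apply: continuous_comp; last exact: continuous_cos.
  by apply: cvgD; [exact: cvg_cst|apply: cvgMl_tmp; exact: cvg_id].
have dF (y : R) : is_derive y 1 (fun y => n%:~R^-1 * sin (s + n%:~R * y))
    (cos (s + n%:~R * y)).
  have d1 : is_derive y 1 (fun y => s + n%:~R * y) n%:~R.
    by apply: is_derive_eq; rewrite add0r mul1r [_ *: 1]mulr1.
  have d2 := @is_derive1_comp _ sin (fun y => s + n%:~R * y) y _ _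
    (is_derive_sin _) d1.
  have := is_deriveZ n%:~R^-1 d2.
  move=> d3; apply: (is_derive_eq d3).
  by rewrite [_ *: _]mulrC -mulrA mulfV // mulr1.
have cF : continuous (fun y : R => n%:~R^-1 * sin (s + n%:~R * y)).
  move=> y; apply: differentiable_continuous; apply/derivable1_diffP.
  by have [] := dF y.
rewrite integral_itv_bndo_bndc; last first.
  apply/measurable_EFinP/measurable_funTS.
  exact: continuous_measurable_fun.
rewrite (@continuous_FTC2 _ _ (fun y => n%:~R^-1 * sin (s + n%:~R * y))).
- by rewrite sinDint2pi mulr0 addr0 subee.
- exact: two_pi_gt0.
- exact: continuous_subspaceT.
- split.
  + by move=> y _; have [] := dF y.
  + by apply: cvg_at_right_filter; exact: cF.
  + by apply: cvg_at_left_filter; exact: cF.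
- by move=> y _; rewrite derive1E; have [] := dF y.
Qed.

(** By Fubini, integrating first in a variable whose frequency is nonzero
    already gives 0 for every value of the other variable. *)
Lemma torus_int_character m n : (m != 0) || (n != 0) ->
  torus_int (character m n) = 0.
Proof.
move=> mn; rewrite /torus_int /Rintegral integral_mkcond.
set f := _ \_ _.
have fi : mu2.-integrable setT f.
  apply: (iffLR (integrable_restrict mu2 measurable_cell measurableT _)).
  by rewrite setTI; exact: integrable_character.
have fE (x y : R) : f (x, y) = if (x \in `[0%R, 2 * pi[) && (y \in `[0%R, 2 * pi[)
    then (character m n (x, y))%:E else 0%E.
  rewrite /f patchE /torus_cell in_setX.
  by rewrite !mem_setE.
have itvE (g : R -> \bar R) :
    (\int[mu]_y (if y \in `[0%R, (2 * pi)%R[ then g y else 0)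
    = \int[mu]_(y in `[0%R, (2 * pi)%R[) g y)%E.
  rewrite [RHS]integral_mkcond; apply: eq_integral => y _.
  by rewrite patchE mem_setE.
have [n0|n0] := eqVneq n 0.
  rewrite -integral21_prod_meas1// integral0_eq// => y _; rewrite /fubini_G.
  under eq_integral do rewrite fE.
  case: (y \in _); last first.
    by rewrite integral0_eq// => x _; rewrite andbF.
  under eq_integral do rewrite andbT.
  rewrite itvE -[RHS](@integral_cos_period (n%:~R * y) m).
    by apply: eq_integral => x _; rewrite /character /= addrC.
  by move: mn; rewrite n0 eqxx orbF.
rewrite -integral12_prod_meas1// integral0_eq// => x _; rewrite /fubini_F.
under eq_integral do rewrite fE.
case: (x \in _) => /=; last by rewrite integral0_eq.
by rewrite itvE; exact: (integral_cos_period (m%:~R * x) n n0).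
Qed.

End TorusIntegrals.
Arguments character {R}.

(** * The mean of the integrand *)

Section Mean.
Variable R : realType.
Local Notation mu := (@lebesgue_measure R).
Local Notation mu2 := (mu \x mu)%E.
Local Notation cell := (@torus_cell R).

(** The list s holds triples of a coefficient and a frequency pair; the constant
    term is kept apart so that it can be read off as the mean. *)
Definition trig_poly (c : R) (s : seq (R * (int * int))) (x : R * R) : R :=
  c + \sum_(t <- s) t.1 * character t.2.1 t.2.2 x.

Lemma trig_poly_int c s :
  all (fun t => (t.2.1 != 0) || (t.2.2 != 0)) s ->
  mu2.-integrable cell (EFin \o trig_poly c s) /\
  torus_int (trig_poly c s) = c * (2 * pi) ^+ 2.
Proof.
elim: s => [_|[k [m n]] s IHs /= /andP[mn /IHs[si sE]]].
  rewrite (_ : trig_poly c [::] = cst c); last first.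
    by apply/funext => x; rewrite /trig_poly big_nil addr0.
  split; first exact: (@bounded_torus_integrable _ _ `|c|).
  rewrite /torus_int Rintegral_cst; last exact: measurable_cell.
  by congr (_ * _); exact (congr1 fine (mu_cell R)).
have -> : trig_poly c ((k, (m, n)) :: s) =
    (fun x => k * character m n x + trig_poly c s x).
  by apply/funext => x; rewrite /trig_poly big_cons /= addrCA.
have ei := @integrable_character R m n.
have kei : mu2.-integrable cell (EFin \o (fun x => k * character m n x)).
  apply: (@bounded_torus_integrable _ _ `|k|).
    by apply: measurable_funM => //; exact: measurable_character.
  by move=> x; rewrite normrM ler_piMr// cos_max.
split; first by refine (integrableD _ kei si); exact: measurable_cell.
rewrite /torus_int RintegralD//; last exact: measurable_cell.
rewrite -/(torus_int _) -/(torus_int _) sE.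
rewrite {1}/torus_int RintegralZl//; last exact: measurable_cell.
by rewrite -/(torus_int _) torus_int_character// mulr0 add0r.
Qed.

(** With A = cos 2x, B = cos 2y, C = cos 2(x + y), one has
    4 a b c = 1 + A + B + C and a^2 = (1 + A) / 2 and so on, so that
    radicand = 3/4 - (A + B + C) / 2 + (A B + A C + B C) / 4.  Because 2 (x + y)
    is the sum of the two other angles, each product is half the sum of the
    third cosine and one new character, e.g. 2 A C = B + cos (4x + 2y). *)
Lemma radicand_trig_poly d : (fun x : R * R => d + radicand x) =
  trig_poly (d + 3 / 4)
   [:: (- (3 / 8), (2, 0)); (- (3 / 8), (0, 2)); (- (3 / 8), (2, 2));
       (1 / 8, (2, -2)); (1 / 8, (4, 2)); (1 / 8, (2, 4))].
Proof.
apply/funext => -[x y]; rewrite /trig_poly !big_cons big_nil /character /=.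
set z := x + y.
have -> : 2%:~R * x + 0%:~R * y = x *+ 2 by ring.
have -> : 0%:~R * x + 2%:~R * y = y *+ 2 by ring.
have -> : 2%:~R * x + 2%:~R * y = z *+ 2 by rewrite /z; ring.
have -> : 2%:~R * x + (-2)%:~R * y = x *+ 2 - y *+ 2 by ring.
have -> : 4%:~R * x + 2%:~R * y = z *+ 2 + x *+ 2 by rewrite /z; ring.
have -> : 2%:~R * x + 4%:~R * y = z *+ 2 + y *+ 2 by rewrite /z; ring.
have prodE (u v : R) : cos (u + v) = 2 * cos u * cos v - cos (u - v).
  by rewrite cosD cosB; ring.
have -> : cos (x *+ 2 - y *+ 2) = 2 * cos (x *+ 2) * cos (y *+ 2) - cos (z *+ 2).
  by rewrite /z mulrnDl (prodE (x *+ 2) (y *+ 2)); ring.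
have -> : cos (z *+ 2 + x *+ 2) = 2 * cos (z *+ 2) * cos (x *+ 2) - cos (y *+ 2).
  by rewrite prodE (_ : z *+ 2 - x *+ 2 = y *+ 2)// /z; ring.
have -> : cos (z *+ 2 + y *+ 2) = 2 * cos (z *+ 2) * cos (y *+ 2) - cos (x *+ 2).
  by rewrite prodE (_ : z *+ 2 - y *+ 2 = x *+ 2)// /z; ring.
rewrite !cos_mulr2n /radicand /= -/z.
(* 2 a b c = a^2 + b^2 + c^2 - 1, from c - a b = - sin x sin y. *)
have zE : cos z = cos x * cos y - sin x * sin y by rewrite cosD.
have : (cos z - cos x * cos y) ^+ 2 = (1 - cos x ^+ 2) * (1 - cos y ^+ 2).
  by rewrite -!sin2cos2 zE; ring.
move: (cos x) (cos y) (cos z) => a b c abc.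
have -> : 4 * a * b * c = 2 * (a ^+ 2 + b ^+ 2 + c ^+ 2 - 1).
  have -> : 4 * a * b * c
      = 2 * (c ^+ 2 + a ^+ 2 * b ^+ 2 - (c - a * b) ^+ 2) by ring.
  by rewrite abc; ring.
by field.
Qed.

Lemma integrable_radicand d :
  mu2.-integrable cell (EFin \o (fun x : R * R => d + radicand x)).
Proof. by rewrite radicand_trig_poly; exact: (trig_poly_int _ _ _).1. Qed.

Lemma torus_int_radicand d :
  torus_int (fun x : R * R => d + radicand x) = (d + 3 / 4) * (2 * pi) ^+ 2.
Proof. by rewrite radicand_trig_poly; exact: (trig_poly_int _ _ _).2. Qed.

(** The right-hand side is the tangent line of the square root at m^2. *)
Lemma sqrt_le_tangent (m p : R) : 0 < m -> 0 <= p ->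
  Num.sqrt p <= (2 * m)^-1 * (m ^+ 2 + p).
Proof.
move=> m0 p0; rewrite ler_pdivlMl ?mulr_gt0// -subr_ge0.
rewrite -{1}(sqr_sqrtr p0).
by rewrite (_ : _ - _ = (m - Num.sqrt p) ^+ 2) ?sqr_ge0//; ring.
Qed.

Local Notation r3 := (Num.sqrt 3 / 2 : R).

Lemma half_sqrt3_gt0 : 0 < r3. Proof. by rewrite divr_gt0// sqrtr_gt0. Qed.

Lemma half_sqrt3_sq : r3 ^+ 2 = 3 / 4.
Proof. by rewrite exprMn sqr_sqrtr//; field. Qed.

Lemma half_sqrt3_lt1 : r3 < 1.
Proof.
rewrite -(ltr_pXn2r (ltn0Sn 1)) ?nnegrE ?(ltW half_sqrt3_gt0)//.
by rewrite half_sqrt3_sq; lra.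
Qed.

(** The tangent line at 3/4, composed with the radicand. *)
Let majorant x := (2 * r3)^-1 * (r3 ^+ 2 + radicand x).

Lemma integrable_majorant : mu2.-integrable cell (EFin \o majorant).
Proof.
by refine (integrableZl _ _ (integrable_radicand _)); exact: measurable_cell.
Qed.

Lemma integrable_sqrt_radicand :
  mu2.-integrable cell (EFin \o (fun x => Num.sqrt (radicand x))).
Proof.
apply: (le_integrable _ _ _ integrable_majorant); first exact: measurable_cell.
  apply/measurable_EFinP; apply: measurableT_comp.
    by apply: continuous_measurable_fun; exact: sqrt_continuous.
  have /measurable_int/measurable_EFinP := integrable_radicand 0.
  by under eq_fun do rewrite add0r.
move=> x _; rewrite /= lee_fin ger0_norm ?sqrtr_ge0//.
by rewrite (le_trans _ (ler_norm _))// sqrt_le_tangent ?radicand_ge0.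
Qed.

Lemma torus_int_sqrt_radicand :
  torus_int (fun x => Num.sqrt (radicand x)) <= r3 * (2 * pi) ^+ 2.
Proof.
have -> : r3 * (2 * pi) ^+ 2 = torus_int majorant.
  rewrite /torus_int RintegralZl; [|exact: measurable_cell
                                   |exact: integrable_radicand].
  rewrite -/(torus_int _) torus_int_radicand -half_sqrt3_sq mulrA; congr (_ * _).
  by have := lt0r_neq0 half_sqrt3_gt0 => ?; field.
apply: le_Rintegral; [exact: measurable_cell|exact: integrable_sqrt_radicand|
                      exact: integrable_majorant|].
by move=> x _; apply: sqrt_le_tangent; [exact: half_sqrt3_gt0|exact: radicand_ge0].
Qed.

End Mean.

(** * Failure of quasiconvexity *)

Theorem lemma2p1 (R : realType) :
  locally_lipschitz (@fnF R) /\
  rank_one_convex (@fnF R) /\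
  ~ quasiconvex_at (@fnF R) 0 /\
  Cinfty_torus (@phiS R) /\
  torus_avg (fun x => fnF (grad (@phiS R) x)) =
    torus_avg (fun x => fnG (I2 + DS (@phiS R) x)) /\
  torus_avg (fun x => fnG (I2 + DS (@phiS R) x)) <= Num.sqrt 3 / 2 /\
  Num.sqrt 3 / 2 < 1 :> R /\
  1 = fnF 0 :> R /\
  fnF 0 = fnG I2 :> R.
Proof.
have F0 : fnF 0 = fnG (@I2 R).
  rewrite /fnF /I2; congr fnG; rewrite !col0.
  by rewrite -(scale0r (0 : 'cV[R]_3)) !opSZ !scale0r !addr0.
have G1 : 1 = fnG (@I2 R).
  rewrite fnGE /gram /hnorm2 !qabs_sq /hdot /= -[LHS]sqrtr1.
  by congr Num.sqrt; ring.
have FGE : (fun x => fnF (grad (@phiS R) x)) = (fun x => fnG (I2 + DS (@phiS R) x)).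
  by apply/funext => x; exact: fnF_grad.
have GE : (fun x => fnG (I2 + DS (@phiS R) x)) = (fun x => Num.sqrt (radicand x)).
  by apply/funext => x; exact: fnG_phiS.
have cell_gt0 : 0 < (2 * pi : R) ^+ 2 by rewrite exprn_gt0// two_pi_gt0.
split; first exact: fnF_locally_lipschitz.
split; first exact: fnF_rank_one_convex.
split.
  move=> /(_ _ (phiS_Cinfty R)); apply/negP; rewrite -ltNge.
  rewrite (_ : (fun x => _) = (fun x => Num.sqrt (radicand x) - 1)); last first.
    by apply/funext => x; rewrite add0r fnF_grad fnG_phiS F0 -G1.
  (* The constant 1 is a trigonometric polynomial with no character in it. *)
  have int1 := trig_poly_int R 1 [::] isT.
  have one : trig_poly R 1 [::] = cst 1.
    by apply/funext => x; rewrite /trig_poly big_nil addr0.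
  rewrite one in int1; case: int1 => i1 E1.
  rewrite /torus_int RintegralB; [|exact: measurable_cell|
    exact: integrable_sqrt_radicand|exact: i1].
  rewrite -/(torus_int _) -/(torus_int (cst 1)) E1 mul1r subr_lt0.
  rewrite (le_lt_trans (torus_int_sqrt_radicand R))//.
  by rewrite gtr_pMl// half_sqrt3_lt1.
split; first exact: phiS_Cinfty.
split; first by rewrite FGE.
split.
  rewrite GE /torus_avg (congr1 fine (mu_cell R)) /=.
  by rewrite ler_pdivrMl// mulrC torus_int_sqrt_radicand.
by rewrite half_sqrt3_lt1 F0 -G1.
Qed.
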